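(* Suppose $M$ is compact and let $\mathcal D_\infty$ be the set of initial conditions that can be steered to $x_e$ by some sequence of admissible control inputs, $$\mathcal D_\infty=\{x_k\in M:\ \exists \{u_{k+i|k}\}_{i\in\mathbb Z_+}\text{ with values in }\mathcal U \text{ such that } \lim_{i\to\infty}x_{k+i|k}=x_e\},$$ where $x_{k|k}=x_k$ and $x_{k+i+1|k}=f(x_{k+i|k},u_{k+i|k})$. Suppose the system is state-unconstrained, so that $\mathcal X=M$, and suppose $\mathcal D_\infty=M$. Then there exists a finite $N^*$ such that $\mathcal D_{N^*}=M$, and therefore the closed-loop system $x_{k+1}=f(x_k,u_k)$, $u_k=u^*_{k|k}$ (with horizon $N=N^*$) is globally asymptotically stable at $x_e$.
   Context: Notation: $\mathbb Z_N=\{0,1,\dots,N-1\}$ and $\mathbb Z_+$ is the set of nonnegative integers. A function $\alpha:[0,a)\to[0,\infty)$ is class $\mathcal K$ if it is strictly increasing and $\alpha(0)=0$; it is class $\mathcal K_\infty$ if moreover $a=\infty$ and $\alpha(x)\to\infty$ as $x\to\infty$. Dynamics and constraints: $M$ is an $n$-dimensional smooth manifold endowed with a metric $d$ (inducing its topology) and $U$ is a compact subset of an $m$-dimensional smooth manifold. The map $f:M\times U\to M$ is continuously differentiable and $f(x_e,u_e)=x_e$ for some $x_e\in M$, $u_e\in U$. The dynamics are $x_{k+1}=f(x_k,u_k)$. The constraint sets $\mathcal X\subset M$ and $\mathcal U\subset U$ are compact and connected, with $x_e\in\operatorname{int}\mathcal X$ and $u_e\in\operatorname{int}\mathcal U$.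 Costs: $L:M\times U\to\mathbb R$ and $F:M\to\mathbb R$ are twice continuously differentiable, with $L(x_e,u_e)=F(x_e)=0$, and for all $x\in M$, $u\in U$: $L(x,u)\ge L(x,u_e)\ge\gamma(d(x,x_e))$ and $F(x)\ge\alpha(d(x,x_e))$, where $\gamma$ is class $\mathcal K_\infty$ and $\alpha$ is class $\mathcal K$. Target set and local control law: $\mathcal X_T\subset\mathcal X$ is compact with $x_e\in\operatorname{int}\mathcal X_T$, and $\kappa:M\to U$ satisfies, for all $x\in\mathcal X_T$: $\kappa(x)\in\mathcal U$; $f(x,\kappa(x))\in\mathcal X_T$; and $F(f(x,\kappa(x)))-F(x)\le -L(x,\kappa(x))$. Finite horizon optimal control problem $(\mathrm{OCP})$ at state $x_k$, with horizon $N$: minimize over $\{u_{k+i|k}\}_{i\in\mathbb Z_N}$ the cost $$\mathcal V_N(x_k;\{u_{k+i|k}\}_{i\in\mathbb Z_N})=F(x_{k+N|k})+\sum_{i\in\mathbb Z_N}L(x_{k+i|k},u_{k+i|k})$$ subject to $x_{k|k}=x_k$ and, for all $i\in\mathbb Z_N$, $x_{k+i+1|k}=f(x_{k+i|k},u_{k+i|k})$, $x_{k+i|k}\in\mathcal X$, $u_{k+i|k}\in\mathcal U$, and the terminal constraint $x_{k+N|k}\in\mathcal X_T$. A minimizing sequence is denoted $\{u^*_{k+i|k}\}_{i\in\mathbb Z_N}$, and the MPC law applies its first element, $u_k=u^*_{k|k}$. The set $\mathcal D_N$ is the set of all $x_k\in M$ for which there exists a sequence $\{u_{k+i|k}\}_{i\in\mathbb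 Z_N}$ satisfying all the constraints of $(\mathrm{OCP})$. Globally asymptotically stable at $x_e$ means: for every $\varepsilon>0$ there is $\delta>0$ such that $d(x_0,x_e)<\delta$ implies $d(x_k,x_e)<\varepsilon$ for all $k>0$, and $d(x_k,x_e)\to0$ as $k\to\infty$ for every $x_0\in M$. *)

(* Defs.v *)
From mathcomp Require Export all_boot all_order all_algebra.
From mathcomp Require Export all_classical all_reals all_analysis.

Set Implicit Arguments.
Unset Strict Implicit.
Unset Printing Implicit Defensive.

Import Order.TTheory GRing.Theory Num.Theory.
Import numFieldNormedType.Exports.

Local Open Scope classical_set_scope.
Local Open Scope ring_scope.

(* [f] is of class C^k on [O] (meant for open [O]): all iterated partial
   derivatives of order at most [k] exist and are continuous at every point
   of [O]. *)
Fixpoint Ck (R : realType) (n : nat) (V : normedModType R) (k : nat)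
    (O : set 'rV[R]_n) (f : 'rV[R]_n -> V) : Prop :=
  {in O, continuous f} /\
  if k is k'.+1 then
    forall i : 'I_n, {in O, forall z, derivable f z (delta_mx 0 i)} /\
                     Ck k' O ('D_(delta_mx 0 i) f)
  else True.

(* Both maps are total; only [cmap] on [cdom] and [cinv] on the image of [cdom]
   are meaningful. *)
Record chart (R : realType) (M : topologicalType) (n : nat) := Chart {
  cdom : set M;
  cmap : M -> 'rV[R]_n;
  cinv : 'rV[R]_n -> M
}.

Definition is_chart (R : realType) (M : topologicalType) (n : nat)
    (c : chart R M n) : Prop :=
  [/\ open (cdom c),
      open (cmap c @` cdom c),
      {in cdom c, cancel (cmap c) (cinv c)},
      {in cdom c, continuous (cmap c)} &
      {in cmap c @` cdom c, continuous (cinv c)}].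

Definition smooth_atlas (R : realType) (M : topologicalType) (n : nat)
    (A : set (chart R M n)) : Prop :=
  [/\ forall c, A c -> is_chart c,
      forall p, exists2 c, A c & cdom c p &
      forall c c' k, A c -> A c' ->
        Ck k (cmap c @` (cdom c `&` cdom c')) (cmap c' \o cinv c)].

Definition smooth_manifold (R : realType) (M : topologicalType) (n : nat)
    (A : set (chart R M n)) : Prop :=
  [/\ hausdorff_space M, @second_countable M & smooth_atlas A].

Definition prod_chart (R : realType) (M P : topologicalType) (n m : nat)
    (c : chart R M n) (c' : chart R P m) : chart R (M * P)%type (n + m) :=
  Chart (cdom c `*` cdom c')
        (fun p => row_mx (cmap c p.1) (cmap c' p.2))
        (fun z => (cinv c (lsubmx z), cinv c' (rsubmx z))).

Definition prod_atlas (R : realType) (M P : topologicalType) (n m : nat)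
    (A : set (chart R M n)) (B : set (chart R P m)) :
    set (chart R (M * P)%type (n + m)) :=
  [set e | exists c c', [/\ A c, B c' & e = prod_chart c c']].

(* Vector-valued functions on the open subset [W] of a manifold. *)
Definition Ck_fun (R : realType) (M : topologicalType) (n : nat)
    (A : set (chart R M n)) (V : normedModType R) (k : nat) (W : set M)
    (f : M -> V) : Prop :=
  forall c, A c -> Ck k (cmap c @` (W `&` cdom c)) (f \o cinv c).

(* Maps from the open subset [W] of a manifold to another manifold. *)
Definition Ck_map (R : realType) (M N : topologicalType) (n m : nat)
    (A : set (chart R M n)) (B : set (chart R N m)) (k : nat) (W : set M)
    (g : M -> N) : Prop :=
  {in W, continuous g} /\
  forall e, B e -> Ck_fun A k (W `&` g @^-1` cdom e) (cmap e \o g).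

(* On an arbitrary subset [S] of a manifold, class C^k means that [f] extends,
   locally around every point of [S], to a C^k map on an open set. *)
Definition Ck_fun_on (R : realType) (M : topologicalType) (n : nat)
    (A : set (chart R M n)) (V : normedModType R) (k : nat) (S : set M)
    (f : M -> V) : Prop :=
  forall p, S p -> exists (W : set M) (g : M -> V),
    [/\ open_nbhs p W, Ck_fun A k W g & {in W `&` S, f =1 g}].

Definition Ck_map_on (R : realType) (M N : topologicalType) (n m : nat)
    (A : set (chart R M n)) (B : set (chart R N m)) (k : nat) (S : set M)
    (f : M -> N) : Prop :=
  forall p, S p -> exists (W : set M) (g : M -> N),
    [/\ open_nbhs p W, Ck_map A B k W g & {in W `&` S, f =1 g}].

(* The domain is [0, a); values of [alpha] elsewhere are irrelevant.
   Nonnegativity on the domain follows. *)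
Definition class_K (R : realType) (a : \bar R) (alpha : R -> R) : Prop :=
  [/\ (0 < a)%E, alpha 0 = 0 &
      forall r s, 0 <= r -> r < s -> (s%:E < a)%E -> alpha r < alpha s].

Definition class_Kinfty (R : realType) (gamma : R -> R) : Prop :=
  class_K +oo%E gamma /\ gamma r @[r --> +oo] --> +oo.

(* Control sequences are indexed by all of [nat]; the problem with horizon [N]
   only depends on the terms of index less than [N]. *)
Fixpoint traj (M P : Type) (f : M * P -> M) (x : M) (u : nat -> P) (i : nat) :
    M :=
  if i is j.+1 then f (traj f x u j, u j) else x.

Definition ocp_feasible (M P : Type) (f : M * P -> M) (X XT : set M)
    (Uc : set P) (N : nat) (x : M) (u : nat -> P) : Prop :=
  (forall i, (i < N)%N -> X (traj f x u i) /\ Uc (u i)) /\ XT (traj f x u N).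

Definition ocp_cost (R : realType) (M P : Type) (f : M * P -> M)
    (L : M * P -> R) (F : M -> R) (N : nat) (x : M) (u : nat -> P) : R :=
  F (traj f x u N) + \sum_(i < N) L (traj f x u i, u i).

Definition ocp_minimizer (R : realType) (M P : Type) (f : M * P -> M)
    (L : M * P -> R) (F : M -> R) (X XT : set M) (Uc : set P) (N : nat)
    (x : M) (u : nat -> P) : Prop :=
  ocp_feasible f X XT Uc N x u /\
  forall v, ocp_feasible f X XT Uc N x v ->
    ocp_cost f L F N x u <= ocp_cost f L F N x v.

Definition D_fin (M P : Type) (f : M * P -> M) (X XT : set M) (Uc : set P)
    (N : nat) : set M :=
  [set x | exists u, ocp_feasible f X XT Uc N x u].

Definition D_infty (M : topologicalType) (P : Type) (f : M * P -> M)
    (Uc : set P) (xe : M) : set M :=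
  [set x | exists2 u : nat -> P, forall i, Uc (u i) &
                                 traj f x u @ \oo --> xe].

(* Minimizers need not be unique, so the closed loop is a transition relation:
   any minimizer may be selected at any step. *)
Definition mpc_step (R : realType) (M P : Type) (f : M * P -> M)
    (L : M * P -> R) (F : M -> R) (X XT : set M) (Uc : set P) (N : nat)
    (x y : M) : Prop :=
  exists2 u, ocp_minimizer f L F X XT Uc N x u & y = f (x, u 0%N).

Definition orbit_of (M : Type) (step : M -> M -> Prop) (x : nat -> M) : Prop :=
  forall k, step (x k) (x k.+1).

Definition gas (R : realType) (M : metricType R) (step : M -> M -> Prop)
    (xe : M) : Prop :=
  (forall eps : R, 0 < eps -> exists2 delta : R, 0 < delta &
     forall x, orbit_of step x -> mdist (x 0%N) xe < delta ->
       forall k, (0 < k)%N -> mdist (x k) xe < eps) /\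
  (forall x, orbit_of step x -> mdist (x k) xe @[k --> \oo] --> (0 : R)).

(* Main.v *)
Require Import Defs.
From mathcomp Require Import zify ring lra.

Set Implicit Arguments.
Unset Strict Implicit.
Unset Printing Implicit Defensive.

Import Order.TTheory GRing.Theory Num.Theory.
Import numFieldNormedType.Exports.

Local Open Scope classical_set_scope.
Local Open Scope ring_scope.

(* Every state can be driven into the interior of the terminal set, and by
   continuity the same controls work on a neighbourhood; the local law keeps
   states in the terminal set, so longer horizons only enlarge the feasible
   set and compactness yields a common horizon. Minimizers exist by Tychonoff
   and continuity of the cost on admissible sequences. Appending one step of
   the local law to the tail of a minimizer shows that the value function V
   decreases by at least gamma (d (x, xe)) along the closed loop, and V is
   bounded by F on the terminal set, so V is a Lyapunov function. *)

(** * Continuity of C^k maps, read off in charts *)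

Lemma cvg_row_mx (T : Type) (G : set_system T) (FG : Filter G)
    (K : numFieldType) (n m : nat) (g : T -> 'rV[K]_n) (h : T -> 'rV[K]_m)
    (A : 'rV[K]_n) (B : 'rV[K]_m) :
  g @ G --> A -> h @ G --> B ->
  (fun t => row_mx (g t) (h t)) @ G --> row_mx A B.
Proof.
move=> gA hB Q [/= E nE sEQ]; apply: (@filterS _ G) => [t |]; first exact: sEQ.
apply: filter_forall => i; apply: filter_forall => j; have := nE i j.
case: (split_ordP j) => k ->.
- rewrite row_mxEl => nE'; have := gA _ (@coord_continuous _ _ _ i k A _ nE').
  by apply: (@filterS _ G) => t /=; rewrite row_mxEl.
- rewrite row_mxEr => nE'; have := hB _ (@coord_continuous _ _ _ i k B _ nE').
  by apply: (@filterS _ G) => t /=; rewrite row_mxEr.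
Qed.

(** The order-zero clause of [Ck] makes [g \o cinv c] continuous at [cmap c p]; composing with
    [cmap c] gives back [g] near [p]. The requirements on [c] are only those used at [p], so that
    product charts can be treated without showing that they satisfy [is_chart]. *)
Lemma Ck_fun_continuous (R : realType) (M : topologicalType) (n k : nat)
    (A : set (chart R M n)) (V : normedModType R) (W : set M) (g : M -> V)
    (c : chart R M n) (p : M) :
  Ck_fun A k W g -> A c -> W p -> nbhs p (cdom c) ->
  {in cdom c, cancel (cmap c) (cinv c)} -> cmap c @ p --> cmap c p ->
  g @ p --> g p.
Proof.
move=> /[apply] gC Wp ncp cK cc; have cp := nbhs_singleton ncp.
have {gC} : {in cmap c @` (W `&` cdom c), continuous (g \o cinv c)}.
  by case: k gC => [|k] [].
move=> /(_ (cmap c p)); rewrite inE.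
move=> /(_ (ex_intro2 _ _ p (conj Wp cp) erefl)).
rewrite /continuous_at /= cK ?inE// => gc.
have : (g \o cinv c) \o cmap c @ p --> g p by apply: cvg_comp cc gc.
apply: cvg_trans; apply: near_eq_cvg.
by apply: filterS ncp => q cq /=; rewrite cK// inE.
Qed.

(** Passes from the local extension [g] supplied by [Ck_map_on] or [Ck_fun_on] to [h] itself; what
    survives is continuity relative to [S]. *)
Lemma cvg_within_eq (T T' : topologicalType) (W S : set T) (g h : T -> T') p :
  open_nbhs p W -> S p -> {in W `&` S, h =1 g} -> g @ p --> g p ->
  h @ within S (nbhs p) --> h p.
Proof.
move=> [oW Wp] Sp hg gc; rewrite hg; last by rewrite inE.
have gS : g @ within S (nbhs p) --> g p by exact: cvg_within_filter.
apply: cvg_trans gS; apply: near_eq_cvg.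
rewrite /prop_near1 /within /=.
have := open_nbhs_nbhs (conj oW Wp).
by apply: filterS => q Wq Sq; rewrite hg// inE.
Qed.

Lemma atlas_continuous (R : realType) (M : topologicalType) (n k : nat)
    (A : set (chart R M n)) (V : normedModType R) (W : set M) (g : M -> V)
    (p : M) :
  smooth_atlas A -> Ck_fun A k W g -> W p -> g @ p --> g p.
Proof.
move=> [cA covA _] gC Wp; have [c Ac cp] := covA p.
have [oc _ cK cc _] := cA _ Ac.
apply: (Ck_fun_continuous gC Ac Wp _ cK); first exact: open_nbhs_nbhs.
by apply: cc; rewrite inE.
Qed.

Lemma prod_atlas_continuous (R : realType) (M P : topologicalType) (n m k : nat)
    (A : set (chart R M n)) (B : set (chart R P m)) (V : normedModType R)
    (W : set (M * P)) (g : M * P -> V) (p : M * P) :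
  smooth_atlas A -> smooth_atlas B -> Ck_fun (prod_atlas A B) k W g -> W p ->
  g @ p --> g p.
Proof.
move=> [cA covA _] [cB covB _] gC Wp.
have [c Ac cp] := covA p.1; have [oc _ cK cc _] := cA _ Ac.
have [e Be ep] := covB p.2; have [oe _ eK ec _] := cB _ Be.
apply: (@Ck_fun_continuous _ _ _ _ _ _ _ _ (prod_chart c e) _ gC) => //=.
- by exists c, e.
- by exists (cdom c, cdom e) => //=; split; exact: open_nbhs_nbhs.
- move=> [x y]; rewrite inE /= => -[/= cx ey].
  by rewrite row_mxKl row_mxKr cK ?eK// inE.
- apply: cvg_row_mx.
  + apply: cvg_comp; [exact: cvg_fst|by apply: cc; rewrite inE].
  + apply: cvg_comp; [exact: cvg_snd|by apply: ec; rewrite inE].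
Qed.

(** * Trajectories and concatenation of control sequences *)

Definition switch (P : Type) (N : nat) (u v : nat -> P) (i : nat) : P :=
  if (i < N)%N then u i else v (i - N)%N.

Section control_sequences.
Context (M P : Type) (f : M * P -> M).
Implicit Types (x : M) (u v : nat -> P) (kappa : M -> P).

(** Records the closed loop of [kappa] as an open-loop sequence, so that it can compete in the
    optimal control problem. *)
Definition feedback kappa x (i : nat) : P :=
  kappa (iter i (fun y => f (y, kappa y)) x).

Lemma traj_feedback kappa x i :
  traj f x (feedback kappa x) i = iter i (fun y => f (y, kappa y)) x.
Proof. by elim: i => //= i ->. Qed.

Lemma eq_traj x u v i : (forall j, (j < i)%N -> u j = v j) ->
  traj f x u i = traj f x v i.
Proof.
elim: i => //= i IHi uv; rewrite uv// IHi// => j ji; apply: uv; exact: ltnW.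
Qed.

Lemma traj_switch N x u v j :
  traj f x (switch N u v) (N + j) = traj f (traj f x u N) v j.
Proof.
elim: j => [|j IHj]; last first.
  by rewrite addnS /= IHj /switch ltnNge leq_addr /= addKn.
by rewrite addn0; apply: eq_traj => j jN; rewrite /switch jN.
Qed.

Lemma traj_switch_lt N x u v i : (i <= N)%N ->
  traj f x (switch N u v) i = traj f x u i.
Proof.
by move=> iN; apply: eq_traj => j ji; rewrite /switch (leq_trans ji iN).
Qed.

Lemma traj_shift x u i :
  traj f x u i.+1 = traj f (f (x, u 0%N)) (fun j => u j.+1) i.
Proof. by elim: i => //= i <-. Qed.

Lemma iter_invariant kappa (XT : set M) x i :
  (forall x, XT x -> XT (f (x, kappa x))) -> XT x ->
  XT (iter i (fun y => f (y, kappa y)) x).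
Proof. by move=> kX Xx; elim: i => //= i; apply: kX. Qed.

Lemma eq_ocp_feasible (X XT : set M) (Uc : set P) N x u v :
  (forall j, (j < N)%N -> u j = v j) ->
  ocp_feasible f X XT Uc N x u -> ocp_feasible f X XT Uc N x v.
Proof.
move=> uv [fu tu]; split; last by rewrite -(eq_traj _ uv).
move=> i iN; rewrite -uv// -(@eq_traj x u v i)//; first exact: fu.
by move=> j ji; apply: uv; exact: ltn_trans iN.
Qed.

Lemma ocp_feasible_feedback (X XT : set M) (Uc : set P) kappa N x :
  XT `<=` X -> (forall x, XT x -> Uc (kappa x)) ->
  (forall x, XT x -> XT (f (x, kappa x))) -> XT x ->
  ocp_feasible f X XT Uc N x (feedback kappa x).
Proof.
move=> XTX kU kX Xx; have inv i := iter_invariant i kX Xx.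
split=> [i _|]; rewrite traj_feedback//.
by split; [exact: XTX|exact: kU].
Qed.

Lemma ocp_feasible_switch (X XT : set M) (Uc : set P) N K x u v :
  (forall i, (i < N)%N -> X (traj f x u i) /\ Uc (u i)) ->
  ocp_feasible f X XT Uc K (traj f x u N) v ->
  ocp_feasible f X XT Uc (N + K) x (switch N u v).
Proof.
move=> fu [fv tv]; split; last by rewrite traj_switch.
move=> i iNK; have [iN|Ni] := ltnP i N.
  by rewrite traj_switch_lt 1?ltnW// /switch iN; exact: fu.
rewrite -{1}(subnKC Ni) traj_switch /switch ltnNge Ni /=; apply: fv; lia.
Qed.

End control_sequences.

(** * Costs of concatenated and feedback controls *)

Section ocp_cost.
Context (R : realType) (M P : Type) (f : M * P -> M).
Variables (L : M * P -> R) (F : M -> R).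
Implicit Types (x : M) (u v : nat -> P) (kappa : M -> P).

Lemma eq_ocp_cost N x u v : (forall j, (j < N)%N -> u j = v j) ->
  ocp_cost f L F N x u = ocp_cost f L F N x v.
Proof.
move=> uv; rewrite /ocp_cost (eq_traj f x uv); congr (_ + _).
apply: eq_bigr => i _; rewrite uv// (@eq_traj _ _ f x u v i)// => j ji.
by apply: uv; exact: ltn_trans (ltn_ord i).
Qed.

Lemma ocp_cost_switch N K x u v :
  ocp_cost f L F (N + K) x (switch N u v) =
  ocp_cost f L F K (traj f x u N) v + \sum_(i < N) L (traj f x u i, u i).
Proof.
rewrite /ocp_cost traj_switch big_split_ord /= -addrA [X in _ + X]addrC.
congr (_ + (_ + _)); apply: eq_bigr => i _.
  by rewrite traj_switch /switch ltnNge leq_addr /= addKn.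
by rewrite traj_switch_lt 1?ltnW// /switch ltn_ord.
Qed.

Lemma ocp_costS N x u :
  ocp_cost f L F N.+1 x u =
  L (x, u 0%N) + ocp_cost f L F N (f (x, u 0%N)) (fun j => u j.+1).
Proof.
rewrite /ocp_cost traj_shift big_ord_recl addrCA; congr (_ + (_ + _)).
by apply: eq_bigr => i _; rewrite lift0 traj_shift.
Qed.

(** Lengthening the horizon by one step replaces the terminal cost [F z] by
    [L (z, kappa z) + F (f (z, kappa z))], which the descent inequality bounds by [F z]. *)
Lemma ocp_cost_feedback_le (XT : set M) kappa N x :
  (forall x, XT x -> XT (f (x, kappa x))) ->
  (forall x, XT x -> F (f (x, kappa x)) - F x <= - L (x, kappa x)) ->
  XT x -> ocp_cost f L F N x (feedback f kappa x) <= F x.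
Proof.
move=> kX kF Xx; elim: N => [|N IHN]; first by rewrite /ocp_cost big_ord0 addr0.
apply: le_trans IHN; rewrite /ocp_cost big_ord_recr /= traj_feedback.
have := kF _ (iter_invariant N kX Xx); rewrite /feedback; lra.
Qed.

End ocp_cost.

(** * Continuous dependence on the initial state and the controls *)

Lemma cvg_to_within (T T' : topologicalType) (I : Type) (G : set_system I)
    (FG : Filter G) (S : set T) (f : T -> T') (h : I -> T) p :
  f @ within S (nbhs p) --> f p -> h @ G --> p ->
  (\forall t \near G, S (h t)) -> (f \o h) @ G --> f p.
Proof.
move=> fc hp hS B /fc; rewrite /nbhs /= /within /= => /hp nB.
by apply: (@filterS2 _ G _ _ _ _ _ hS nB) => t /= St; apply.
Qed.

Section continuous_dependence.
Context (R : realType) (M P : topologicalType) (U : set P) (f : M * P -> M).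
Hypothesis fc : forall p, U p.2 -> f @ within ([set: M] `*` U) (nbhs p) --> f p.
Context (I : Type) (G : set_system I) (FG : Filter G).
Variables (x : I -> M) (x0 : M) (u : I -> nat -> P) (u0 : nat -> P).
Hypothesis xx0 : x @ G --> x0.
Hypothesis uu0 : forall i, (fun t => u t i) @ G --> u0 i.
Hypothesis uU : forall i, \forall t \near G, U (u t i).
Hypothesis u0U : forall i, U (u0 i).

(** The filter [G] is arbitrary because two limits are needed: the state varies under fixed controls
    when feasibility is propagated to a neighbourhood, and the controls vary from a fixed state when
    minimizers are sought. *)
Lemma cvg_traj i : (fun t => traj f (x t) (u t) i) @ G --> traj f x0 u0 i.
Proof.
elim: i => //= i IHi.
apply: (cvg_to_within (h := fun t => (traj f (x t) (u t) i, u t i))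
  _ (fc (p := (traj f x0 u0 i, u0 i)) _)) => //.
- exact: u0U.
- exact: cvg_pair.
- by apply: filterS (uU i) => t.
Qed.

Lemma cvg_ocp_cost (L : M * P -> R) (F : M -> R) N :
  (forall p, U p.2 -> L @ within ([set: M] `*` U) (nbhs p) --> L p) ->
  continuous F ->
  (fun t => ocp_cost f L F N (x t) (u t)) @ G --> ocp_cost f L F N x0 u0.
Proof.
move=> Lc Fc; apply: cvgD.
  by apply: cvg_comp; [exact: cvg_traj|exact: Fc].
apply: cvg_big => [|i _]; first exact: add_continuous.
apply: (cvg_to_within (h := fun t => (traj f (x t) (u t) i, u t i))
  _ (Lc (traj f x0 u0 i, u0 i) _)) => //.
- exact: u0U.
- by apply: cvg_pair => //; exact: cvg_traj.
- by apply: filterS (uU i) => t.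
Qed.

End continuous_dependence.

Lemma closure_within (T T' : topologicalType) (S C : set T) (B : set T')
    (h : T -> T') p :
  h @ within S (nbhs p) --> h p -> C `<=` S -> (forall q, C q -> B (h q)) ->
  closure C p -> closure B (h p).
Proof.
move=> hc CS CB Cp D /hc nD; have [q [Cq Dq]] := Cp _ nD.
by exists (h q); split; [exact: CB|exact/Dq/CS].
Qed.

(** * Feasible sets and existence of minimizers *)

Section optimal_control.
Context (R : realType) (M P : topologicalType) (U Uc : set P) (f : M * P -> M).
Hypothesis UcU : Uc `<=` U.
Hypothesis fc : forall p, U p.2 -> f @ within ([set: M] `*` U) (nbhs p) --> f p.
Variables (X XT : set M) (kappa : M -> P).
Hypothesis XTX : XT `<=` X.
Hypothesis kU : forall x, XT x -> Uc (kappa x).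
Hypothesis kX : forall x, XT x -> XT (f (x, kappa x)).

Lemma D_fin_nondecreasing N K : (N <= K)%N ->
  D_fin f X XT Uc N `<=` D_fin f X XT Uc K.
Proof.
move=> NK x [u [fu tu]].
exists (switch N u (feedback f kappa (traj f x u N))); rewrite -(subnKC NK).
by apply: ocp_feasible_switch fu _; exact: ocp_feasible_feedback.
Qed.

Lemma D_fin_cover xe : compact [set: M] -> X = setT -> XT° xe ->
  D_infty f Uc xe = setT -> \forall N \near \oo, D_fin f X XT Uc N = setT.
Proof.
move=> cM XE iXT Dinf.
suff : \forall N \near \oo, setT `<=` D_fin f X XT Uc N.
  by apply: filterS => N sD; apply/seteqP; split.
(* In the near-covering form of compactness, each [x] only needs a neighbourhood and a threshold
   such that all states in the one are feasible for all horizons beyond the other. *)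
apply: (compact_near_coveringP _).1 cM _ _ _ _ _ => x _.
have : D_infty f Uc xe x by rewrite Dinf.
(* The trajectory is caught in the interior of [XT], so that [XT] is a neighbourhood of the state
   reached at time [N]. *)
move=> [u uUc ux]; have [N _ uN] := ux _ (nbhs_interior iXT).
have : (fun y => traj f y u N) @ x --> traj f x u N.
  apply: (cvg_traj fc) => [//|i|i|i]; first exact: cvg_cst.
    by near do exact: UcU.
  exact: UcU.
move=> /(_ _ (uN N (leqnn N))) nx.
exists ([set y | XT (traj f y u N)], [set K | (N <= K)%N]).
  by split => //=; exists N.
move=> [y K] /= [yXT NK]; apply: D_fin_nondecreasing NK _ _; exists u.
by split => // i _; rewrite XE; split.
Unshelve. all: by end_near. Qed.

Lemma ocp_minimizer_exists (L : M * P -> R) (F : M -> R) N x :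
  (forall p, U p.2 -> L @ within ([set: M] `*` U) (nbhs p) --> L p) ->
  continuous F -> compact Uc -> closed X -> closed XT -> Uc !=set0 ->
  D_fin f X XT Uc N x -> exists u, ocp_minimizer f L F X XT Uc N x u.
Proof.
move=> Lc Fc cUc clX clXT [w Ucw] [v fv].
(* The topology of pointwise convergence makes [S] a product of copies of [Uc], hence compact by
   Tychonoff. *)
pose S : set {ptws nat -> P} := [set u | forall i, Uc (u i)].
have cS : compact S by exact: (@tychonoff nat (fun=> P) (fun=> Uc)) _.
have Scvg (u : {ptws nat -> P}) : S u ->
  [/\ forall i, (fun u' : {ptws nat -> P} => u' i) @ within S (nbhs u) --> u i,
      forall i, \forall u' \near within S (nbhs u), U (u' i) &
      forall i, U (u i)].
  move=> Su; split=> i; last exact: UcU.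
  - pose h (u' : {ptws nat -> P}) := u' i.
    have hu : h @ u --> h u := @proj_continuous nat (fun=> P) i u.
    exact: (@cvg_within_filter _ _ h (nbhs u) (nbhs_filter u) _ S hu).
  - by rewrite /prop_near1 /within /=; apply: nearW => u' Su'; exact: UcU.
pose C := S `&` [set u | ocp_feasible f X XT Uc N x u].
have trajc (u : {ptws nat -> P}) i : S u ->
  (fun u' : {ptws nat -> P} => traj f x u' i) @ within S (nbhs u)
    --> traj f x u i.
  by move=> /Scvg[uc uU u0U]; apply: (cvg_traj fc) => //; exact: cvg_cst.
have CS : C `<=` S by move=> u [].
have cC : compact C.
  (* Trajectories are known to depend continuously on the controls only within [S], so [C] is shown
     to be closed relative to [S]. *)
  suff <- : S `&` closure C = C.
    by apply: compact_closedI => //; exact: closed_closure.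
  apply/seteqP; split=> [u [Su clu]|u Cu]; last first.
    by split; [exact: CS|exact: subset_closure].
  split=> //; split=> [i iN|].
    split; last exact: Su.
    apply/clX/(closure_within (trajc u i Su) CS _ clu) => u'.
    by case=> _ [/(_ i iN)[]].
  by apply/clXT/(closure_within (trajc u N Su) CS _ clu) => u' [_ []].
(* Feasibility leaves the controls from index [N] on unconstrained. Resetting them to [w] brings the
   sequence into [S] without changing its cost. *)
pose fix_tail (u : nat -> P) : nat -> P := switch N u (fun=> w).
have tailE u j : (j < N)%N -> u j = fix_tail u j.
  by rewrite /fix_tail /switch => ->.
have tailC u : ocp_feasible f X XT Uc N x u -> C (fix_tail u).
  move=> fu; split; last exact: eq_ocp_feasible (tailE u) fu.
  by move=> i; rewrite /fix_tail /switch; case: ifP => [/fu.1[]|].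
pose J (u : {ptws nat -> P}) := ocp_cost f L F N x u.
have [||c Cc cmin] := compact_EVT_min (f := J) _ cC.
- by exists (fix_tail v); exact: tailC.
- apply/subspace_continuousP => u [Su _].
  have [uc uU u0U] := Scvg _ Su.
  have Jc : J @ within S (nbhs u) --> J u.
    by apply: (cvg_ocp_cost fc) => //; exact: cvg_cst.
  move=> B /Jc; rewrite /nbhs /= /within /=.
  by apply: (@filterS _ _ (nbhs_filter u)) => u1 SB /CS.
- exists c; rewrite inE in Cc; split; first by case: Cc.
  move=> u fu; rewrite (eq_ocp_cost _ _ _ _ (tailE u)).
  by apply: (cmin (fix_tail u)); rewrite inE; exact: tailC.
Unshelve. all: by end_near. Qed.

End optimal_control.

(** * Lyapunov functions and asymptotic stability *)

Lemma lyapunov_gas (R : realType) (M : metricType R) (step : M -> M -> Prop)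
    (xe : M) (V : M -> R) (gamma : R -> R) :
  class_Kinfty gamma ->
  (forall x, gamma (mdist x xe) <= V x) ->
  (forall x y, step x y -> V y <= V x - gamma (mdist x xe)) ->
  (forall eps, 0 < eps -> \forall x \near xe, V x < eps) ->
  gas step xe.
Proof.
move=> [[_ g0 gI] _] gV dV cV.
have g_ge0 r : 0 <= r -> 0 <= gamma r.
  rewrite le_eqVlt => /predU1P[<-|r0]; first by rewrite g0.
  by rewrite -g0 ltW// gI// ltry.
have g_gt0 r : 0 < r -> 0 < gamma r by move=> r0; rewrite -g0 gI// ltry.
have g_lt r s : 0 <= r -> 0 <= s -> gamma r < gamma s -> r < s.
  move=> r0 s0; apply: contraTT; rewrite -!leNgt le_eqVlt.
  by move=> /predU1P[->//|sr]; rewrite ltW// gI// ltry.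
split=> [eps eps0|x ox].
(* Stability: [V] starts below [gamma eps] and never increases, and [gamma] of the distance stays
   below [V]; [g_lt] then inverts [gamma]. *)
- have := cV _ (g_gt0 _ eps0).
  move=> /metricType_numDomainType.nbhs_mdistP[/= d d0 dV'].
  exists d => // x ox x0 k _; apply: g_lt; rewrite ?mdist_ge0 ?ltW//.
  apply: le_lt_trans (gV _) _; apply: le_lt_trans (dV' (x 0%N) _); last first.
    by rewrite /= metric_sym.
  elim: k => // k; apply: le_trans; apply: le_trans (dV _ _ (ox k)) _.
  by rewrite gerBl g_ge0// mdist_ge0.
(* Attractivity: the decrease of [V] telescopes, so the series of [gamma] of the distances has
   partial sums bounded by [V (x 0)] and its terms tend to 0. *)
- have sum_le k :
    \sum_(0 <= i < k) gamma (mdist (x i) xe) <= V (x 0%N) - V (x k).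
    elim: k => [|k IHk]; first by rewrite big_geq// subrr.
    by rewrite big_nat_recr//=; have := dV _ _ (ox k); lra.
  have : (fun k => gamma (mdist (x k) xe)) @ \oo --> (0 : R).
    apply: cvg_series_cvg_0; apply: nondecreasing_is_cvgn.
      apply: nondecreasing_series => i _ _; exact/g_ge0/mdist_ge0.
    exists (V (x 0%N)) => _ [k _ <-]; apply: le_trans (sum_le k) _.
    rewrite gerBl; apply: le_trans (gV _); exact/g_ge0/mdist_ge0.
  move=> /cvgrPdist_lt gc; apply/cvgrPdist_lt => eps eps0.
  apply: filterS (gc _ (g_gt0 _ eps0)) => k /=.
  rewrite !sub0r !normrN !ger0_norm ?mdist_ge0 ?g_ge0 ?mdist_ge0//.
  by apply: g_lt; rewrite ?mdist_ge0 ?ltW.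
Qed.

(** * The value function along the closed loop *)

Theorem proposition2 (R : realType)
  (n m : nat) (M : metricType R) (P : topologicalType)
  (AM : set (chart R M n)) (AP : set (chart R P m))
  (hM : smooth_manifold AM) (hP : smooth_manifold AP)
  (U : set P) (hU : compact U)
  (f : M * P -> M) (hf : Ck_map_on (prod_atlas AM AP) AM 1 ([set: M] `*` U) f)
  (xe : M) (ue : P) (hue : U ue) (hfe : f (xe, ue) = xe)
  (X : set M) (hXcompact : compact X) (hXconnected : connected X)
  (hXe : X° xe)
  (Uc : set P) (hUcU : Uc `<=` U)
  (hUccompact : compact Uc) (hUcconnected : connected Uc)
  (hUce : within U (nbhs ue) Uc)
  (L : M * P -> R) (hL : Ck_fun_on (prod_atlas AM AP) 2 ([set: M] `*` U) L)
  (F : M -> R) (hF : Ck_fun AM 2 [set: M] F)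
  (hLe : L (xe, ue) = 0) (hFe : F xe = 0)
  (gamma : R -> R) (hgamma : class_Kinfty gamma)
  (hLmin : forall x u, U u -> L (x, ue) <= L (x, u))
  (hLgamma : forall x, gamma (mdist x xe) <= L (x, ue))
  (a : \bar R) (alpha : R -> R) (halpha : class_K a alpha)
  (hFalpha : forall x, ((mdist x xe)%:E < a)%E /\ alpha (mdist x xe) <= F x)
  (XT : set M) (hXTX : XT `<=` X) (hXTcompact : compact XT) (hXTe : XT° xe)
  (kappa : M -> P) (hkappaU : forall x, U (kappa x))
  (hkappaUc : forall x, XT x -> Uc (kappa x))
  (hkappaXT : forall x, XT x -> XT (f (x, kappa x)))
  (hkappaF : forall x, XT x ->
    F (f (x, kappa x)) - F x <= - L (x, kappa x))
  (hMcompact : compact [set: M])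
  (hXM : X = [set: M])
  (hDinfty : D_infty f Uc xe = [set: M]) :
  exists N : nat,
    [/\ (0 < N)%N,
        D_fin f X XT Uc N = [set: M],
        forall x, exists u, ocp_minimizer f L F X XT Uc N x u &
        gas (mpc_step f L F X XT Uc N) xe].
Proof.
have [_ _ sM] := hM; have [_ _ sP] := hP.
have fc (p : M * P) : U p.2 -> f @ within ([set: M] `*` U) (nbhs p) --> f p.
  move=> Up.
  have [W [g [Wp [gc _] fg]]] := hf p (conj I Up : ([set: M] `*` U) p).
  apply: (cvg_within_eq Wp _ fg) => //.
  by apply: gc; rewrite inE; case: Wp.
have Lc (p : M * P) : U p.2 -> L @ within ([set: M] `*` U) (nbhs p) --> L p.
  move=> Up; have [W [g [Wp gC Lg]]] := hL p (conj I Up : ([set: M] `*` U) p).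
  apply: (cvg_within_eq Wp _ Lg) => //.
  by apply: (prod_atlas_continuous sM sP gC); case: Wp.
have Fc : continuous F by move=> p; exact: atlas_continuous sM hF _.
have [g0 g_lt] : gamma 0 = 0 /\ forall r, 0 < r -> 0 < gamma r.
  by have [[_ g0 gI] _] := hgamma; split=> // r r0; rewrite -g0 gI// ltry.
have gL x u : U u -> gamma (mdist x xe) <= L (x, u).
  by move=> Uu; apply: le_trans (hLgamma x) (hLmin _ _ Uu).
have L_ge0 x u : U u -> 0 <= L (x, u).
  move=> Uu; apply: le_trans (gL x u Uu).
  have := mdist_ge0 x xe; rewrite le_eqVlt => /predU1P[<-|/g_lt/ltW//].
  by rewrite g0.
have F_ge0 x : 0 <= F x.
  have [xa] := hFalpha x; apply: le_trans; have [_ a0 aI] := halpha.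
  have := mdist_ge0 x xe; rewrite le_eqVlt => /predU1P[<-|d0].
    by rewrite a0.
  by rewrite -a0 ltW// aI.
(* The horizon must be positive for a first control to be applied; this is possible because all
   large horizons are feasible everywhere. *)
have [N [DN N0]] : exists N, D_fin f X XT Uc N = setT /\ (0 < N)%N.
  apply: (@filter_ex _ \oo); apply: filterI; last exact: nbhs_infty_gt.
  exact: (D_fin_cover hUcU fc hXTX hkappaUc hkappaXT hMcompact hXM hXTe).
have minE x : exists u, ocp_minimizer f L F X XT Uc N x u.
  apply: (ocp_minimizer_exists hUcU fc) => //.
  - exact: (compact_closed (@metric_hausdorff _ _)).
  - exact: (compact_closed (@metric_hausdorff _ _)).
  - by exists (kappa xe); apply: hkappaUc; exact: interior_subset hXTe.
  - by rewrite DN.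
exists N; split=> //.
(* A selection of minimizers serves only to define the value function [V]; the closed loop remains
   free to apply other minimizers. *)
have [um umP] := choice minE.
pose V x := ocp_cost f L F N x (um x).
have V_le x u : ocp_feasible f X XT Uc N x u -> V x <= ocp_cost f L F N x u.
  by move=> fu; apply: (umP x).2.
case: N N0 => [//|N] _ in DN minE um umP V V_le *.
apply: (@lyapunov_gas _ _ _ _ V gamma hgamma).
- move=> x; have [[fu _] _] := umP x; have uU i : (i < N.+1)%N -> U (um x i).
    by move=> iN; apply: hUcU; case: (fu i iN).
  apply: le_trans (gL x (um x 0%N) (uU _ _)) _ => //.
  rewrite /V /ocp_cost big_ord_recl addrCA lerDl addr_ge0// sumr_ge0// => i _.
  by apply/L_ge0/uU.
- move=> x y [u [[fu tu] uopt] ->].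
  set z := traj f x u N.+1 in tu.
  (* The tail of [u] lasts [N] steps and ends at [z], which lies in [XT]; the last of the [N.+1]
     controls is [kappa z]. *)
  pose w := switch N (fun j => u j.+1) (feedback f kappa z).
  have trajE i : traj f (f (x, u 0%N)) (fun j => u j.+1) i = traj f x u i.+1.
    by rewrite traj_shift.
  have fw : ocp_feasible f X XT Uc N.+1 (f (x, u 0%N)) w.
    rewrite -addn1; apply: ocp_feasible_switch => [i iN|]; rewrite trajE.
      exact: fu.
    exact: ocp_feasible_feedback.
  (* The applied minimizer [u] may differ from [um x], hence the comparison through the minimality
     of [u]. *)
  have Vx : ocp_cost f L F N.+1 x u <= V x by apply: uopt; exact: (umP x).1.
  apply: le_trans (V_le _ _ fw) _.
  (* Relative to [u], the first stage cost is dropped and the terminal cost [F z] is replaced by the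
     cost of one step of the local law from [z], itself at most [F z]. *)
  have -> : ocp_cost f L F N.+1 (f (x, u 0%N)) w =
    ocp_cost f L F 1 z (feedback f kappa z)
    + (ocp_cost f L F N.+1 x u - L (x, u 0%N) - F z).
    rewrite (ocp_costS _ _ _ N x u) -[in LHS]addn1 ocp_cost_switch trajE -/z.
    rewrite /ocp_cost trajE; ring.
  have := ocp_cost_feedback_le 1 hkappaXT hkappaF tu.
  have := gL x (u 0%N) (hUcU _ (fu 0%N isT).2); lra.
- move=> eps eps0; have Fe := Fc xe; rewrite /continuous_at hFe in Fe.
  have Flt : \forall x \near xe, F x < eps by exact: (cvgr_lt (0 : R)).
  (* On [XT] the local feedback is a feasible competitor of cost at most [F x], so [V] is small near
     [xe] because [F] is. *)
  apply: filterS2 Flt (hXTe : nbhs xe XT) => x Fx XTx; move: Fx.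
  apply: le_lt_trans.
  apply: le_trans (ocp_cost_feedback_le N.+1 hkappaXT hkappaF XTx).
  by apply: V_le; exact: ocp_feasible_feedback.
Qed.
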